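(* Let $U$ be a Riemann surface domain with complex coordinate $z$ and let $y:U\to S^6$ be a totally isotropic (conformally immersed) surface. Suppose there exists an isotropic frame $\{E_1,E_2\}$, consisting of sections of the complexified normal bundle $V^{\perp}_{\mathbb C}$ of $y$, such that, for $i,j=1,2$, $$\kappa,\ D_z\kappa,\ D_{\bar z}\kappa\in \mathrm{Span}_{\mathbb C}\{E_1,E_2\},$$ $$\langle E_i,E_j\rangle=0,\qquad \langle E_i,\bar E_j\rangle=\delta_{ij},$$ $$D_zE_i\in \mathrm{Span}_{\mathbb C}\{E_1,E_2\},\qquad D_{\bar z}E_i\in \mathrm{Span}_{\mathbb C}\{E_1,E_2\}.$$ Then $y$ is a Willmore surface.
   Context: Let $\mathbb R^{8}_1$ be $\mathbb R^8$ with the Lorentzian metric $\langle x,y\rangle=-x_0y_0+\sum_{j=1}^{7}x_jy_j$, extended complex bilinearly to $\mathbb C^8$. Let $y:U\to S^6$ be a conformal immersion and $z$ a complex coordinate. The canonical lift with respect to $z$ is $Y=e^{-\omega}(1,y)$, where $e^{2\omega}=2\langle y_z,y_{\bar z}\rangle$. One has the orthogonal bundle decomposition $U\times\mathbb R^8_1=V\oplus V^\perp$ with $V=\mathrm{Span}\{Y,\mathrm{Re}\,Y_z,\mathrm{Im}\,Y_z,Y_{z\bar z}\}$; $V^\perp$ is the (conformal) normal bundle (rank 4, positive definite), $V^\perp_{\mathbb C}$ its complexification, and $D$ is the normal connection on $V^\perp_{\mathbb C}$ (differentiate in $\mathbb C^8$ and project orthogonally to $V^\perp_{\mathbb C}$).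 The conformal Hopf differential $\kappa\in\Gamma(V^\perp_{\mathbb C})$ and the Schwarzian $s$ (complex-valued) are defined by $Y_{zz}=-\frac s2Y+\kappa$. The surface $y$ is Willmore iff $D_{\bar z}D_{\bar z}\kappa+\frac{\bar s}{2}\kappa=0$. (For every conformal immersion one has the conformal Codazzi equation $\mathrm{Im}(D_{\bar z}D_{\bar z}\kappa+\frac{\bar s}{2}\kappa)=0$.) The surface $y$ is totally isotropic if $\langle Y_z^{(m)},Y_z^{(n)}\rangle=0$ for all positive integers $m,n$, where $Y_z^{(m)}$ is the $m$-th derivative of $Y$ with respect to $z$. *)

(* Defs.v *)
From HB Require Import structures.
From mathcomp Require Import all_boot all_order all_algebra.
From mathcomp Require Import all_classical all_reals all_analysis.
From mathcomp Require Import complex.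

Set Implicit Arguments.
Unset Strict Implicit.
Unset Printing Implicit Defensive.

Import Order.TTheory GRing.Theory Num.Theory.
Import numFieldNormedType.Exports.

Local Open Scope classical_set_scope.
Local Open Scope ring_scope.
Local Open Scope complex_scope.

(* The point (u, v) of R * R stands for the value z = u + i v of the complex
   coordinate, so that a surface patch is identified with its image in C. *)

Section Calculus.
Variable R : realType.
Implicit Types U : set (R * R).

Fixpoint Ck U (W : normedModType R) (k : nat) (f : R * R -> W) : Prop :=
  match k with
  | 0%N => forall p, U p -> {for p, continuous f}
  | k'.+1 => (forall p, U p -> differentiable f p) /\
             (forall v, Ck U k' (fun p => 'D_v f p))
  end.

Definition smooth_on U (W : normedModType R) (f : R * R -> W) : Prop :=
  forall k, Ck U k f.

Definition cplx_row n (x : 'rV[R]_n) : 'rV[R[i]]_n := map_mx (real_complex R) x.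
Definition re_row n (x : 'rV[R[i]]_n) : 'rV[R]_n := map_mx (@complex.Re R) x.
Definition im_row n (x : 'rV[R[i]]_n) : 'rV[R]_n := map_mx (@complex.Im R) x.
Definition conj_row n (x : 'rV[R[i]]_n) : 'rV[R[i]]_n := map_mx (@conjc R) x.

Definition csmooth_on U n (F : R * R -> 'rV[R[i]]_n) : Prop :=
  smooth_on U (fun p => re_row (F p)) /\ smooth_on U (fun p => im_row (F p)).

(* Real directional derivative, taken on real and imaginary parts because
   'rV[R[i]]_n carries no real normed-space structure in the library. *)
Definition cderive n (v : R * R) (F : R * R -> 'rV[R[i]]_n) (p : R * R)
    : 'rV[R[i]]_n :=
  cplx_row ('D_v (fun q => re_row (F q)) p) + 'i *: cplx_row ('D_v (fun q => im_row (F q)) p).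

Definition dz n (F : R * R -> 'rV[R[i]]_n) (p : R * R) : 'rV[R[i]]_n :=
  2^-1 *: (cderive (1, 0) F p - 'i *: cderive (0, 1) F p).
Definition dzbar n (F : R * R -> 'rV[R[i]]_n) (p : R * R) : 'rV[R[i]]_n :=
  2^-1 *: (cderive (1, 0) F p + 'i *: cderive (0, 1) F p).

End Calculus.

Definition dot (K : comPzRingType) n (x y : 'rV[K]_n) : K :=
  \sum_(j < n) x 0 j * y 0 j.

Definition lorentz_mx (K : comPzRingType) n : 'M[K]_(1 + n) :=
  block_mx (- 1%:M) 0 0 1%:M.

Definition lorentz (K : comPzRingType) n (x y : 'rV[K]_(1 + n)) : K :=
  (x *m lorentz_mx K n *m y^T) 0 0.

Section Surface.
Variable R : realType.
Local Notation C := R[i].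
Local Notation frame_field := (R * R -> 'rV[C]_(1 + 7)).
Implicit Types (U : set (R * R)) (p : R * R) (y : R * R -> 'rV[R]_7).

Record conformal_immersion U y : Prop := ConformalImmersion {
  ci_smooth : smooth_on U y;
  ci_sphere : forall p, U p -> dot (y p) (y p) = 1;
  ci_immersion : forall p, U p ->
    row_free (col_mx ('D_((1, 0) : R * R) y p) ('D_((0, 1) : R * R) y p));
  ci_conformal : forall p, U p ->
    let yu := 'D_((1, 0) : R * R) y p in
    let yv := 'D_((0, 1) : R * R) y p in
    dot yu yu = dot yv yv /\ dot yu yv = 0 }.

Definition omega y p : R :=
  let yC q := cplx_row (y q) in
  ln (complex.Re (2 * dot (dz yC p) (dzbar yC p))) / 2.

Definition lift_real y p : 'rV[R]_(1 + 7) :=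
  expR (- omega y p) *: row_mx 1%:M (y p).

Definition canonical_lift y : frame_field := fun p => cplx_row (lift_real y p).

(* Row spaces of these matrices are the fibres of the complexified bundles. *)
Definition V_C y p : 'M[C]_(1 + 7) :=
  let Y := canonical_lift y in
  (Y p + cplx_row (re_row (dz Y p)) + cplx_row (im_row (dz Y p)) + dzbar (dz Y) p)%MS.

(* Row space = { x | lorentz x w = 0 for all w in V_C }. *)
Definition Vperp_C y p : 'M[C]_(1 + 7) :=
  kermx (lorentz_mx C 7 *m (V_C y p)^T).

Definition normal_proj y p (x : 'rV[C]_(1 + 7)) : 'rV[C]_(1 + 7) :=
  x *m proj_mx (Vperp_C y p) (V_C y p).

Definition Dz y (psi : frame_field) : frame_field :=
  fun p => normal_proj y p (dz psi p).
Definition Dzbar y (psi : frame_field) : frame_field :=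
  fun p => normal_proj y p (dzbar psi p).

Definition normal_section U y (psi : frame_field) : Prop :=
  csmooth_on U psi /\ forall p, U p -> (psi p <= Vperp_C y p)%MS.

(* kappa is the conformal Hopf differential and s the Schwarzian: for a
   conformal immersion the equation determines both of them on U. *)
Definition hopf_schwarzian U y (kappa : frame_field) (s : R * R -> C) : Prop :=
  normal_section U y kappa /\
  let Y := canonical_lift y in
  forall p, U p -> dz (dz Y) p = - (s p / 2) *: Y p + kappa p.

Definition willmore U y : Prop :=
  exists (kappa : frame_field) (s : R * R -> C),
    hopf_schwarzian U y kappa s /\
    forall p, U p ->
      Dzbar y (Dzbar y kappa) p + ((s p)^* / 2) *: kappa p = 0.

Definition totally_isotropic U y : Prop :=
  let Y := canonical_lift y in
  forall m n : nat, (0 < m)%N -> (0 < n)%N -> forall p, U p ->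
    lorentz (iter m (@dz R (1 + 7)) Y p) (iter n (@dz R (1 + 7)) Y p) = 0.

Definition span2 (E : 'I_2 -> frame_field) p : 'M[C]_(2, 1 + 7) :=
  \matrix_(i < 2) E i p.

Record isotropic_frame U y (kappa : frame_field) (E : 'I_2 -> frame_field)
    : Prop := IsotropicFrame {
  if_section : forall i, normal_section U y (E i);
  if_kappa : forall p, U p ->
    [/\ (kappa p <= span2 E p)%MS,
        (Dz y kappa p <= span2 E p)%MS &
        (Dzbar y kappa p <= span2 E p)%MS];
  if_isotropic : forall i j p, U p -> lorentz (E i p) (E j p) = 0;
  if_unitary : forall i j p, U p ->
    lorentz (E i p) (conj_row (E j p)) = (i == j)%:R;
  if_parallel : forall i p, U p ->
    (Dz y (E i) p <= span2 E p)%MS /\ (Dzbar y (E i) p <= span2 E p)%MS }.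

End Surface.

(* Main.v *)
Require Import Defs.
From HB Require Import structures.
From mathcomp Require Import all_boot all_order all_algebra.
From mathcomp Require Import all_classical all_reals all_analysis.
From mathcomp Require Import complex ring lra.

(* Let W = D_zbar D_zbar kappa + (conj s / 2) kappa. The hypotheses make
   L = Span(E_1, E_2) stable under D_zbar, and kappa and D_zbar kappa are
   sections of L, so W is a section of L. By the conformal Codazzi equation W is
   real. But L is isotropic and meets its conjugate only in 0, so W = 0. The
   Codazzi equation itself comes from projecting Y_zzzbarzbar, which is real
   because the partial derivatives commute, to the normal bundle. *)

Set Implicit Arguments.
Unset Strict Implicit.
Unset Printing Implicit Defensive.

Import Order.TTheory GRing.Theory Num.Theory.
Import numFieldNormedType.Exports.

Local Open Scope classical_set_scope.
Local Open Scope ring_scope.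
Local Open Scope complex_scope.

(** The obstacle is the normal projection. It is given by [proj_mx] onto the kernel of a matrix
    varying with the point, a form that cannot be differentiated. It is therefore rewritten as
    [normal_part], whose coefficients are Lorentz products with Y, Y_z, Y_zbar, Y_zzbar. The Gram
    matrix of these four fields is constant except for <Y_zzbar, Y_zzbar>: all its other entries
    follow from <Y, Y> = 0 (the lift lies on the light cone), <Y_z, Y_z> = 0 (total isotropy) and
    <Y_z, Y_zbar> = 1/2 (the factor e^(-omega)), by differentiation and conjugation. Regularity is
    the second concern. D_zbar kappa must be smooth before the product rule applies to it, which is
    read off from an explicit formula; the Schwarzian is a bare function and is recovered as 4
    <Y_zz, Y_zzbar>, which is smooth. Identities between fields hold only on the open set U, so each
    is localised before it is differentiated. *)

(** * Calculus of C^k maps on an open set of the plane *)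

Section RealSmoothness.
Variables (R : realType) (U : set (R * R)).
Hypothesis oU : open U.
Implicit Types W : normedModType R.

Lemma near_open p : U p -> \forall q \near p, U q.
Proof. by move=> Up; apply: open_nbhs_nbhs. Qed.

Lemma eq_on_near (T : Type) (f g : R * R -> T) p :
  (forall q, U q -> f q = g q) -> U p -> \near p, f p = g p.
Proof. by move=> fg /near_open; apply: filterS. Qed.

Lemma eq_on_derive W (f g : R * R -> W) v p :
  (forall q, U q -> f q = g q) -> U p -> 'D_v f p = 'D_v g p.
Proof. by move=> fg Up; apply: near_eq_derive; exact: eq_on_near. Qed.

(** The little-o expansion that characterises the differential involves only values near [p], where
    [f] and [g] agree, so [g] inherits the expansion of [f] with the same linear part. *)
Lemma eq_on_differentiable W (f g : R * R -> W) p :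
  (forall q, U q -> f q = g q) -> U p -> differentiable f p ->
  differentiable g p.
Proof.
move=> fg Up /diff_locallyP [cdf /eqaddoP fo].
have nU : \forall h \near (0 : R * R), U (h + p).
  by move: (near_open Up); rewrite (near_shift 0) /= subr0.
suff go : g \o shift p = (cst (g p) + 'd f p : R * R -> W) +o_ (0 : R * R) id.
  apply/diff_locallyP; have dg := diff_unique cdf go; rewrite dg; split=> //.
apply/eqaddoP => e e0; have := fo e e0.
apply: filterS2 nU => h Uhp; rewrite !fctE/= /shift/= !fg//.
Qed.

Lemma eq_on_Ck W k (f g : R * R -> W) :
  (forall p, U p -> f p = g p) -> Ck U k f -> Ck U k g.
Proof.
elim: k f g => [|k IH] f g fg /=.
  move=> cf p Up; have nfg := eq_on_near fg Up.
  rewrite /prop_for /continuous_at -(fg _ Up).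
  exact: cvg_trans (near_eq_cvg nfg) (cf p Up).
move=> [df ckf]; split=> [p Up|v].
  exact: eq_on_differentiable fg Up (df p Up).
apply: IH (ckf v) => p Up; exact: eq_on_derive.
Qed.

Lemma Ck_pred W k (f : R * R -> W) : Ck U k.+1 f -> Ck U k f.
Proof.
elim: k f => [|k IH] f [df ckf].
  by move=> p Up; apply: differentiable_continuous; exact: df.
by split=> // v; apply: IH; exact: ckf.
Qed.

Lemma CkD W k (f g : R * R -> W) :
  Ck U k f -> Ck U k g -> Ck U k (fun p => f p + g p).
Proof.
elim: k f g => [|k IH] f g; first by move=> cf cg p Up; apply: cvgD; [exact: cf|exact: cg].
move=> [df cf] [dg cg]; split=> [p Up|v].
  by apply: differentiableD; [exact: df|exact: dg].
apply: (eq_on_Ck _ (IH _ _ (cf v) (cg v))) => p Up.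
by rewrite (@deriveD _ _ _ f g) //; apply: diff_derivable; [exact: df|exact: dg].
Qed.

Lemma Ck_cst W k (c : W) : Ck U k (fun=> c).
Proof.
elim: k c => [|k IH] c; first by move=> p Up; exact: cvg_cst.
split=> [p Up|v]; first exact: differentiable_cst.
by apply: (eq_on_Ck _ (IH 0)) => p Up; rewrite derive_cst.
Qed.

Lemma derive_linear W W' (L : {linear W -> W'}) (f : R * R -> W) v p :
  continuous L -> differentiable f p ->
  differentiable (fun q => L (f q)) p /\ 'D_v (fun q => L (f q)) p = L ('D_v f p).
Proof.
move=> cL df.
have dL q : differentiable L q by exact: linear_differentiable.
have dLf : differentiable (L \o f) p by exact: differentiable_comp.
split=> //; rewrite (_ : (fun q => L (f q)) = L \o f)// deriveE//.
by rewrite diff_comp// diff_lin//= deriveE.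
Qed.

Lemma Ck_linear W W' (L : {linear W -> W'}) k (f : R * R -> W) :
  continuous L -> Ck U k f -> Ck U k (fun p => L (f p)).
Proof.
move=> cL; elim: k f => [|k IH] f.
  by move=> cf p Up; apply: continuous_comp; [exact: cf|exact: cL].
move=> [df cf]; split=> [p Up|v]; first by have [] := derive_linear 0 cL (df p Up).
apply: (eq_on_Ck _ (IH _ (cf v))) => p Up.
by have [] := derive_linear v cL (df p Up).
Qed.

Lemma CkM k (f g : R * R -> R) :
  Ck U k f -> Ck U k g -> Ck U k (fun p => f p * g p).
Proof.
elim: k f g => [|k IH] f g; first by move=> cf cg p Up; apply: cvgM; [exact: cf|exact: cg].
move=> Cf Cg; have [df cf] := Cf; have [dg cg] := Cg; split=> [p Up|v].
  by apply: differentiableM; [exact: df|exact: dg].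
have := CkD (IH _ _ (Ck_pred Cf) (cg v)) (IH _ _ (Ck_pred Cg) (cf v)).
apply: eq_on_Ck => p Up.
by rewrite (@deriveM _ _ f g)//; apply: diff_derivable; [exact: df|exact: dg].
Qed.

Lemma derive_comp_real (phi : R -> R) (d : R) (f : R * R -> R) v p :
  differentiable f p -> is_derive (f p) 1 phi d ->
  differentiable (fun q => phi (f q)) p /\
  'D_v (fun q => phi (f q)) p = d * 'D_v f p.
Proof.
move=> df dphi.
have dp : differentiable phi (f p) by apply/derivable1_diffP; exact: ex_derive.
have dpf : differentiable (phi \o f) p by exact: differentiable_comp.
split=> //; rewrite (_ : (fun q => phi (f q)) = phi \o f)// deriveE//.
rewrite diff_comp//= -(deriveE v df) mulrC -[d in RHS]derive_val -derive1E.
exact: (congr1 (@^~ ('D_v f p)) (diff1E dp)).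
Qed.

(** The function t^(-1/2), written so that its value at e^(2 omega) unfolds to the factor e^(-omega)
    of the canonical lift. *)
Definition rsqrt (t : R) : R := expR (- (ln t / 2)).

Lemma rsqrt_sqr (t : R) : 0 < t -> rsqrt t ^+ 2 * t = 1.
Proof.
move=> t0; rewrite /rsqrt -expRM_natl mulrN -[X in - X](mulrC _ 2) divfK ?pnatr_eq0//.
by rewrite -{2}(lnK t0) -expRD addrC subrr expR0.
Qed.

(** The derivative - t^(-3/2) / 2 is expressed as a polynomial in [rsqrt t]; the induction in
    [Ck_rsqrt] then needs only products. *)
Lemma is_derive_rsqrt (t : R) : 0 < t -> is_derive t 1 rsqrt (- 2^-1 * rsqrt t ^+ 3).
Proof.
move=> t0; have -> : - 2^-1 * rsqrt t ^+ 3 = rsqrt t * (- (2^-1 * t^-1)).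
  have -> : t^-1 = rsqrt t ^+ 2.
    by apply: (mulIf (lt0r_neq0 t0)); rewrite mulVf ?lt0r_neq0// rsqrt_sqr.
  by ring.
apply: (@is_derive1_comp _ expR (fun x => - (ln x / 2))).
have := is_deriveN (is_deriveZ 2^-1 (is_derive1_ln t0)).
rewrite /GRing.scale /=; congr (is_derive _ _ _ _).
by apply/funext => x; rewrite !fctE mulrC.
Qed.

Lemma Ck_rsqrt k (g : R * R -> R) :
  (forall p, U p -> 0 < g p) -> Ck U k g -> Ck U k (fun p => rsqrt (g p)).
Proof.
move=> g0; elim: k => [|k IH].
  move=> cg p Up; apply: (@continuous_comp _ _ _ g rsqrt); first exact: cg.
  apply: differentiable_continuous; apply/derivable1_diffP.
  by have dr := is_derive_rsqrt (g0 _ Up); exact: ex_derive.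
move=> Cg; have [dg cg] := Cg; split=> [p Up|v].
  by have [] := derive_comp_real 0 (dg _ Up) (is_derive_rsqrt (g0 _ Up)).
have Cr := IH (Ck_pred Cg).
have := CkM (CkM (Ck_cst k (- 2^-1 : R)) (CkM Cr (CkM Cr Cr))) (cg v).
apply: eq_on_Ck => p Up.
have [_ ->] := derive_comp_real v (dg _ Up) (is_derive_rsqrt (g0 _ Up)).
by rewrite exprS expr2.
Qed.

End RealSmoothness.

(** * Symmetry of second derivatives *)

Section Schwarz.
Variables (R : realType) (U : set (R * R)).
Hypothesis oU : open U.

Lemma is_derive_line (W : normedModType R) (f : R * R -> W) (u q : R * R) (s : R) :
  derivable f (s *: u + q) u ->
  is_derive s 1 (fun x : R => f (x *: u + q)) ('D_u f (s *: u + q)).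
Proof.
have E : (fun h : R => h^-1 *: (f ((h *: 1 + s) *: u + q) - f (s *: u + q)))
       = (fun h : R => h^-1 *: (f (h *: u + (s *: u + q)) - f (s *: u + q))).
  by apply/funext => h; rewrite scalerDl [h *: 1]mulr1 addrA.
move=> df; apply: DeriveDef; first by move: df; rewrite /derivable -E.
by rewrite /derive -E.
Qed.

(** The mean value theorem in the direction [u] turns the second difference into t times an
    increment of ['D_u f] along t v. Differentiability of ['D_u f] at the single point [p] then
    evaluates this increment up to o(t). *)
Lemma second_difference (f : R * R -> R) (u v p : R * R) (e : R) :
  (forall q, U q -> differentiable f q) -> U p ->
  differentiable ('D_u f) p -> 0 < e ->
  exists2 d : R, 0 < d & forall t : R, 0 < t -> t < d ->
    `|f (t *: u + (t *: v + p)) - f (t *: u + p) - f (t *: v + p) + f p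
      - t ^+ 2 * 'D_v ('D_u f) p| <= e * t ^+ 2.
Proof.
(* The two error terms below have total size at most |c u + t v| + |c u| <= t (2 |u| + |v|) for 0 <
   c < t; the added 1 keeps [K] positive when u = v = 0. *)
move=> df Up dg e0; pose K := 2 * `|u| + `|v| + 1.
have u0 := normr_ge0 u; have v0 := normr_ge0 v.
have K0 : 0 < K by rewrite /K; lra.
rewrite (deriveE v dg).
set L := 'd ('D_u f) p.
have LD (a b : R) : 'd ('D_u f) p (a *: u + b *: v) = a * L u + b * L v.
  by rewrite linearD; congr (_ + _); exact: linearZ.
have /diff_locallyP [_ /eqaddoP go] := dg.
have eK0 : 0 < e / K by rewrite divr_gt0.
have nU : \forall h \near (0 : R * R), U (h + p).
  by move: (near_open oU Up); rewrite (near_shift 0) /= subr0.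
have [r /= r0 Hr] := nbhs_norm0P.1 (filterI nU (go _ eK0)).
exists (r / K); first by rewrite divr_gt0.
move=> t t0; rewrite ltr_pdivlMr// => tK.
have small (a b : R) : `|a| <= t -> `|b| <= t -> `|a *: u + b *: v| <= t * (`|u| + `|v|).
  move=> at' bt; rewrite (le_trans (ler_normD _ _))// !normrZ mulrDr.
  by rewrite lerD// ler_wpM2r.
have tr : t * (`|u| + `|v|) < r.
  by apply: le_lt_trans tK; rewrite ler_wpM2l ?ltW// /K; lra.
have Us (a b : R) : `|a| <= t -> `|b| <= t -> U (a *: u + (b *: v + p)).
  move=> at' bt; rewrite addrA.
  by have [] := Hr (a *: u + b *: v) (le_lt_trans (small _ _ at' bt) tr).
have Lerr (a b : R) : `|a| <= t -> `|b| <= t ->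
    `|'D_u f (a *: u + (b *: v + p)) - ('D_u f p + (a * L u + b * L v))|
      <= e / K * `|a *: u + b *: v|.
  move=> at' bt.
  have [_] := Hr (a *: u + b *: v) (le_lt_trans (small _ _ at' bt) tr).
  by rewrite !fctE /shift/= addrA LD.
have t00 : `|0 : R| <= t by rewrite normr0 ltW.
have tt : `|t| <= t by rewrite gtr0_norm.
(* The term [0 *: v] gives both points the form a u + b v + p, so that [Us] and [Lerr] apply to
   both. *)
pose phi (s : R) : R := f (s *: u + (t *: v + p)) - f (s *: u + (0 *: v + p)).
pose dphi (s : R) : R := 'D_u f (s *: u + (t *: v + p)) - 'D_u f (s *: u + (0 *: v + p)).
have dl (s b : R) : `|s| <= t -> `|b| <= t ->
   is_derive s 1 (fun x : R => f (x *: u + (b *: v + p))) ('D_u f (s *: u + (b *: v + p))).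
  by move=> st bt; apply: is_derive_line; apply: diff_derivable; apply: df; exact: Us.
have dph (s : R) : `|s| <= t -> is_derive s 1 phi (dphi s).
  by move=> st; apply: is_deriveB; apply: dl.
have inT (s : R) : s \in `[0, t] -> `|s| <= t.
  by rewrite in_itv/= => /andP[s0 st]; rewrite ger0_norm.
have [c ct Ec] : exists2 c, c \in `]0, t[%R & phi t - phi 0 = dphi c * (t - 0).
  apply: MVT => //.
    by move=> x xt; apply: dph; apply: inT; exact: subset_itv_oo_cc.
  apply: derivable_within_continuous => x xt.
  by have := dph _ (inT _ xt) => ?; exact: ex_derive.
have ct' : `|c| <= t by apply: inT; exact: subset_itv_oo_cc.
rewrite subr0 /phi !scale0r !add0r in Ec.
rewrite opprB addrA in Ec.
have -> : f (t *: u + (t *: v + p)) - f (t *: u + p) - f (t *: v + p) + f p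
  = dphi c * t by rewrite -Ec; ring.
have H1 := Lerr c t ct' tt; have H2 := Lerr c 0 ct' t00.
set A := 'D_u f _ in H1; set B := 'D_u f (c *: u + (0 *: v + p)) in H2.
set B0 := 'D_u f p in H1 H2.
rewrite -[dphi c]/(A - B).
(* The linear parts at the two points differ by exactly t L v, so only the two expansion errors
   remain. *)
rewrite (_ : (A - B) * t - t ^+ 2 * L v
  = ((A - (B0 + (c * L u + t * L v))) - (B - (B0 + (c * L u + 0 * L v)))) * t); last by ring.
rewrite normrM (gtr0_norm t0) expr2 mulrA ler_pM2r//.
apply: (le_trans (ler_normB _ _)); apply: (le_trans (lerD H1 H2)).
rewrite -mulrDr -mulrA ler_pM2l// mulrC ler_pdivrMr//.
have H3 : `|c *: u + t *: v| <= t * `|u| + t * `|v| by rewrite -mulrDr small.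
have H4 : `|c *: u + 0 *: v| <= t * `|u|.
  by rewrite scale0r addr0 normrZ ler_wpM2r.
rewrite (le_trans (lerD H3 H4))// /K; nra.
Qed.

(** The second difference is symmetric in [u] and [v], and divided by t^2 it approximates both mixed
    derivatives. *)
Lemma derive_comm (f : R * R -> R) (u v p : R * R) : Ck U 2 f -> U p ->
  'D_v ('D_u f) p = 'D_u ('D_v f) p.
Proof.
move=> [df ddf] Up; apply/eqP; rewrite -subr_eq0 -normr_le0; apply/ler_addgt0Pl => e e0.
rewrite addr0.
have e20 : 0 < e / 2 by rewrite divr_gt0.
have [d d0 Hd] := second_difference v df Up ((ddf u).1 p Up) e20.
have [d' d'0 Hd'] := second_difference u df Up ((ddf v).1 p Up) e20.
pose t := Num.min d d' / 2.
have m0 : 0 < Num.min d d' by rewrite lt_min d0.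
have t0 : 0 < t by rewrite divr_gt0.
have [td td'] : t < d /\ t < d'.
  by apply/andP; rewrite -lt_min /t ltr_pdivrMr// mulrDr mulr1 ltrDl.
have := Hd t t0 td; have := Hd' t t0 td'.
rewrite (addrCA (t *: v)).
move: (f (_ + (_ + _))) (f (t *: u + p)) (f (t *: v + p)) (f p) => A B B' P.
move: ('D_v _ p) ('D_u _ p) => X Y HY HX.
have t20 : 0 < t ^+ 2 by rewrite exprn_gt0.
rewrite -(ler_pM2l t20) -{1}(gtr0_norm t20) -normrM.
have -> : t ^+ 2 * (X - Y)
  = (A - B' - B + P - t ^+ 2 * Y) - (A - B - B' + P - t ^+ 2 * X) by ring.
by rewrite (le_trans (ler_normB _ _))// (le_trans (lerD HY HX))// -mulrDl -splitr mulrC.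
Qed.

End Schwarz.

(** * Wirtinger calculus for complex scalar functions *)

Section ComplexFunctions.
Variables (R : realType) (U : set (R * R)).
Hypothesis oU : open U.
Local Notation C := R[i].
Local Notation Re := complex.Re.
Local Notation Im := complex.Im.
Implicit Types (W : normedModType R) (a b : R * R -> C) (f g : R * R -> R) (p v : R * R) (e : C).

Lemma ReD (x y : C) : Re (x + y) = Re x + Re y. Proof. by case: x y => [? ?] []. Qed.
Lemma ImD (x y : C) : Im (x + y) = Im x + Im y. Proof. by case: x y => [? ?] []. Qed.
Lemma ReM (x y : C) : Re (x * y) = Re x * Re y - Im x * Im y.
Proof. by case: x y => [? ?] []. Qed.
Lemma ImM (x y : C) : Im (x * y) = Re x * Im y + Im x * Re y.
Proof. by case: x y => [? ?] []. Qed.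
Lemma complex_ext (x y : C) : Re x = Re y -> Im x = Im y -> x = y.
Proof. by case: x y => [? ?] [? ?] /= -> ->. Qed.

Lemma conjcD (x y : C) : conjc (x + y) = conjc x + conjc y. Proof. exact: rmorphD. Qed.
Lemma conjcM (x y : C) : conjc (x * y) = conjc x * conjc y. Proof. exact: rmorphM. Qed.

Lemma smoothD W (f g : R * R -> W) :
  smooth_on U f -> smooth_on U g -> smooth_on U (fun p => f p + g p).
Proof. by move=> sf sg k; apply: CkD. Qed.

Lemma smoothM f g : smooth_on U f -> smooth_on U g -> smooth_on U (fun p => f p * g p).
Proof. by move=> sf sg k; apply: CkM. Qed.

Lemma smoothN f : smooth_on U f -> smooth_on U (fun p => - f p).
Proof.
move=> sf k; have := CkM oU (Ck_cst oU k (-1 : R)) (sf k).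
by apply: eq_on_Ck => // p _; rewrite mulN1r.
Qed.

Lemma smooth_derivable W (f : R * R -> W) p v :
  smooth_on U f -> U p -> derivable f p v.
Proof. by move=> sf Up; apply: diff_derivable; have [df _] := sf 1%N; exact: df. Qed.

Lemma smooth_derive W (f : R * R -> W) v :
  smooth_on U f -> smooth_on U ('D_v f).
Proof. by move=> sf k; have [_ df] := sf k.+1; exact: df. Qed.

Definition csm a := smooth_on U (fun p => Re (a p)) /\ smooth_on U (fun p => Im (a p)).

Lemma eq_csm a b : (forall p, U p -> a p = b p) -> csm a -> csm b.
Proof.
move=> ab [sr si]; split=> k; [move: (sr k)|move: (si k)];
  by apply: eq_on_Ck => // p /ab ->.
Qed.

Lemma csm_cst (c : C) : csm (fun=> c).
Proof. by split=> k; apply: Ck_cst. Qed.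

Lemma csm_real f : smooth_on U f -> csm (fun p => (f p)%:C).
Proof. by move=> sf; split=> // k; apply: Ck_cst. Qed.

Lemma csm_conj a : csm a -> csm (fun p => conjc (a p)).
Proof.
move=> [sr si]; split=> k.
  by apply: eq_on_Ck (sr k) => // p _; case: (a p).
by apply: eq_on_Ck (smoothN si k) => // p _; case: (a p).
Qed.

Lemma csmD a b : csm a -> csm b -> csm (fun p => a p + b p).
Proof.
move=> [ra ia] [rb ib]; split=> k.
  by apply: eq_on_Ck (smoothD ra rb k) => // p _; rewrite ReD.
by apply: eq_on_Ck (smoothD ia ib k) => // p _; rewrite ImD.
Qed.

Lemma csmM a b : csm a -> csm b -> csm (fun p => a p * b p).
Proof.
move=> [ra ia] [rb ib]; split=> k.
  apply: eq_on_Ck (smoothD (smoothM ra rb) (smoothN (smoothM ia ib)) k) => // p _.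
  by rewrite ReM.
apply: eq_on_Ck (smoothD (smoothM ra ib) (smoothM ia rb) k) => // p _.
by rewrite ImM.
Qed.

Lemma csm_sum (I : Type) (r : seq I) (F : I -> R * R -> C) :
  (forall i, csm (F i)) -> csm (fun p => \sum_(i <- r) F i p).
Proof.
move=> sF; elim: r => [|i r IH].
  by apply: eq_csm (csm_cst 0) => p _; rewrite big_nil.
by apply: eq_csm (csmD (sF i) IH) => p _; rewrite big_cons.
Qed.

Definition cD v a p : C := 'D_v (fun q => Re (a q)) p +i* 'D_v (fun q => Im (a q)) p.

Lemma csm_cD v a : csm a -> csm (cD v a).
Proof. by move=> [ra ia]; split; exact: smooth_derive. Qed.

Lemma eq_cD v a b p : (forall q, U q -> a q = b q) -> U p -> cD v a p = cD v b p.
Proof. by move=> ab Up; congr (_ +i* _); apply: (eq_on_derive oU) => // q /ab ->. Qed.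

Lemma cD_cst v c p : cD v (fun=> c) p = 0.
Proof. by rewrite /cD !derive_cst. Qed.

Lemma cDD v a b p : csm a -> csm b -> U p ->
  cD v (fun q => a q + b q) p = cD v a p + cD v b p.
Proof.
move=> [ra ia] [rb ib] Up; apply: complex_ext; rewrite (ReD, ImD) /=.
  rewrite -deriveD; try exact: smooth_derivable.
  by apply: eq_on_derive Up => // q _; rewrite ReD.
rewrite -deriveD; try exact: smooth_derivable.
by apply: eq_on_derive Up => // q _; rewrite ImD.
Qed.

Lemma cDM v a b p : csm a -> csm b -> U p ->
  cD v (fun q => a q * b q) p = cD v a p * b p + a p * cD v b p.
Proof.
move=> [ra ia] [rb ib] Up.
have dM f g : smooth_on U f -> smooth_on U g ->
    'D_v (fun q => f q * g q) p = f p * 'D_v g p + g p * 'D_v f p.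
  by move=> sf sg; apply: (@deriveM _ _ f g); exact: smooth_derivable.
apply: complex_ext; rewrite (ReD, ImD) !(ReM, ImM) /=.
  rewrite (@eq_on_derive _ _ oU _ _
    (fun q => Re (a q) * Re (b q) + - (Im (a q) * Im (b q)))) //; last first.
    by move=> q _; rewrite ReM.
  rewrite (@deriveD _ _ _ (fun q => Re (a q) * Re (b q)) (fun q => - (Im (a q) * Im (b q))));
    try by apply: smooth_derivable => //; try apply: smoothN; apply: smoothM.
  rewrite (@deriveN _ _ _ (fun q => Im (a q) * Im (b q)));
    last by apply: smooth_derivable => //; apply: smoothM.
  by rewrite !dM//; ring.
rewrite (@eq_on_derive _ _ oU _ _
    (fun q => Re (a q) * Im (b q) + Im (a q) * Re (b q))) //; last first.
  by move=> q _; rewrite ImM.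
rewrite (@deriveD _ _ _ (fun q => Re (a q) * Im (b q)) (fun q => Im (a q) * Re (b q)));
    try by apply: smooth_derivable => //; apply: smoothM.
by rewrite !dM//; ring.
Qed.

Lemma cD_conj v a p : csm a -> U p -> cD v (fun q => conjc (a q)) p = conjc (cD v a p).
Proof.
move=> [ra ia] Up; apply: complex_ext => /=.
  by apply: eq_on_derive Up => // q _; case: (a q).
rewrite -(deriveN (smooth_derivable (v := v) ia Up)).
by apply: (eq_on_derive oU) => // q _; rewrite fctE; case: (a q).
Qed.

Lemma cD_comm u v a p : csm a -> U p -> cD v (cD u a) p = cD u (cD v a) p.
Proof.
move=> [ra ia] Up; apply: complex_ext.
  exact: (derive_comm oU u v (ra 2%N) Up).
exact: (derive_comm oU u v (ia 2%N) Up).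
Qed.

(* [wder (- 'i)] and [wder 'i] are the Wirtinger derivatives with respect to
   [z] and to its conjugate. *)
Definition wder e a p : C := 2^-1 * (cD (1, 0) a p + e * cD (0, 1) a p).

Lemma csm_wder e a : csm a -> csm (wder e a).
Proof.
move=> sa; apply: csmM; first exact: csm_cst.
by apply: csmD; [exact: csm_cD|apply: csmM; [exact: csm_cst|exact: csm_cD]].
Qed.

Lemma eq_wder e a b p : (forall q, U q -> a q = b q) -> U p -> wder e a p = wder e b p.
Proof. by move=> ab Up; rewrite /wder !(eq_cD _ ab Up). Qed.

Lemma wder_cst e c p : wder e (fun=> c) p = 0.
Proof. by rewrite /wder !cD_cst mulr0 addr0 mulr0. Qed.

Lemma wderD e a b p : csm a -> csm b -> U p ->
  wder e (fun q => a q + b q) p = wder e a p + wder e b p.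
Proof. by move=> sa sb Up; rewrite /wder !cDD//; ring. Qed.

Lemma wderM e a b p : csm a -> csm b -> U p ->
  wder e (fun q => a q * b q) p = wder e a p * b p + a p * wder e b p.
Proof. by move=> sa sb Up; rewrite /wder !cDM//; ring. Qed.

Lemma wder_sum e (I : Type) (r : seq I) (F : I -> R * R -> C) p :
  (forall i, csm (F i)) -> U p ->
  wder e (fun q => \sum_(i <- r) F i q) p = \sum_(i <- r) wder e (F i) p.
Proof.
move=> sF Up; elim: r => [|i r IH].
  rewrite big_nil -[RHS](wder_cst e (0 : C) p).
  by apply: eq_wder => // q _; rewrite big_nil.
rewrite big_cons -IH -wderD//; last exact: csm_sum.
by apply: eq_wder => // q _; rewrite big_cons.
Qed.

Lemma wder_conj e a p : csm a -> U p ->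
  wder e (fun q => conjc (a q)) p = conjc (wder (conjc e) a p).
Proof.
move=> sa Up; rewrite /wder !cD_conj//.
rewrite !(conjcD, conjcM). by rewrite conjcK conjc_inv conjc_nat.
Qed.

Lemma wder_comm e e' a p : csm a -> U p -> wder e (wder e' a) p = wder e' (wder e a) p.
Proof.
have E w w' q : csm a -> U q -> wder w (wder w' a) q =
    2^-1 * (2^-1 * ((cD (1, 0) (cD (1, 0) a) q + w' * cD (1, 0) (cD (0, 1) a) q)
      + w * (cD (0, 1) (cD (1, 0) a) q + w' * cD (0, 1) (cD (0, 1) a) q))).
  move=> sa Uq; rewrite {1}/wder.
  have s1 := csm_cD (1, 0) sa; have s2 := csm_cD (0, 1) sa.
  have sc c := csm_cst c.
  have F v : cD v (wder w' a) q =
      2^-1 * (cD v (cD (1, 0) a) q + w' * cD v (cD (0, 1) a) q).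
    have sm := csmM (sc w') s2.
    rewrite (cDM _ (sc _) (csmD s1 sm))// (cDD _ s1 sm)//.
    by rewrite (cDM _ (sc _) s2)// !cD_cst !mul0r !add0r.
  by rewrite !F mulrCA -mulrDr.
move=> sa Up; rewrite !E// (cD_comm (1, 0) (0, 1) sa Up); congr (_ * (_ * _)).
by rewrite !mulrDr (mulrCA e) addrACA.
Qed.

End ComplexFunctions.

(** One operator covers [dz] (e = -i) and [dzbar] (e = i): conjugating a field conjugates the
    parameter, and commutation is a single statement about two parameters. *)
HB.lock Definition wirt (R : realType) n e (F : R * R -> 'rV[R[i]]_n) p : 'rV[R[i]]_n :=
  2^-1 *: (cderive (1, 0) F p + e *: cderive (0, 1) F p).

(** * Wirtinger calculus for row-valued fields, by coordinates *)

Section ComplexRows.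
Variables (R : realType) (U : set (R * R)).
Hypothesis oU : open U.
Local Notation C := R[i].
Local Notation Re := complex.Re.
Local Notation Im := complex.Im.

Lemma smooth_coord n (G : R * R -> 'rV[R]_n) j :
  smooth_on U G -> smooth_on U (fun p => G p 0 j).
Proof.
have lin : linear (fun M : 'rV[R]_n => M 0 j : R) by move=> c A B; rewrite !mxE.
pose L : {linear 'rV[R]_n -> R} := HB.pack (fun M : 'rV[R]_n => M 0 j)
  (GRing.isLinear.Build _ _ _ _ _ lin).
move=> sG k; apply: (@Ck_linear _ _ oU _ _ L) => //; exact: coord_continuous.
Qed.

Lemma smooth_row n (G : R * R -> 'rV[R]_n) :
  (forall j, smooth_on U (fun p => G p 0 j)) -> smooth_on U G.
Proof.
move=> sG.
have sT (r : seq 'I_n) :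
    smooth_on U (fun p => \sum_(j <- r) G p 0 j *: (delta_mx 0 j : 'rV[R]_n)).
  elim: r => [|j r IH] k.
    by apply: eq_on_Ck (Ck_cst oU k 0) => // p _; rewrite big_nil.
  have sj : Ck U k (fun p => G p 0 j *: (delta_mx 0 j : 'rV[R]_n)).
    have lin : linear (fun x : R => x *: (delta_mx 0 j : 'rV[R]_n)).
      by move=> c x y; rewrite scalerDl scalerA.
    pose L : {linear R -> 'rV[R]_n} := HB.pack
      (fun x : R => x *: (delta_mx 0 j : 'rV[R]_n))
      (GRing.isLinear.Build _ _ _ _ _ lin).
    apply: (@Ck_linear _ _ oU _ _ L); last exact: sG.
    exact: scalel_continuous.
  by apply: eq_on_Ck (CkD oU sj (IH k)) => // p _; rewrite big_cons.
move=> k; apply: eq_on_Ck (sT (index_enum _) k) => // p _.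
by rewrite [RHS]row_sum_delta.
Qed.

Lemma csmooth_onP n (F : R * R -> 'rV[C]_n) :
  csmooth_on U F <-> forall j, csm U (fun p => F p 0 j).
Proof.
split=> [[sr si] j|sF].
  split=> k; [move: (smooth_coord j sr k)|move: (smooth_coord j si k)];
    by apply: eq_on_Ck => // p _; rewrite mxE.
by split; apply: smooth_row => j k; [move: ((sF j).1 k)|move: ((sF j).2 k)];
  apply: eq_on_Ck => // p _; rewrite mxE.
Qed.

Lemma cderiveE n v (F : R * R -> 'rV[C]_n) p j : csmooth_on U F -> U p ->
  cderive v F p 0 j = cD v (fun q => F q 0 j) p.
Proof.
move=> [sr si] Up; rewrite /cderive !mxE !derive_mx; try exact: smooth_derivable Up.
rewrite !mxE /cD.
have Ecx (x y : R) : x%:C + 'i%C * y%:C = x +i* y by apply: complex_ext => /=; ring.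
by rewrite Ecx; congr (_ +i* _); congr ('D_v _ p); apply/funext => q; rewrite mxE.
Qed.

Lemma dz_wirt n (F : R * R -> 'rV[C]_n) : dz F = wirt (- 'i%C) F.
Proof. by apply/funext => p; rewrite /dz unlock scaleNr. Qed.

Lemma dzbar_wirt n (F : R * R -> 'rV[C]_n) : dzbar F = wirt 'i%C F.
Proof. by rewrite unlock. Qed.

Section Rows.
Variable n : nat.
Implicit Types (F G : R * R -> 'rV[C]_n) (a : R * R -> C) (e : C).

Let coordD (A B : 'rV[C]_n) j : (A + B) 0 j = A 0 j + B 0 j.
Proof. by rewrite mxE. Qed.
Let coordZ (c : C) (A : 'rV[C]_n) j : (c *: A) 0 j = c * A 0 j.
Proof. by rewrite mxE. Qed.
Let coord_conj (A : 'rV[C]_n) j : conj_row A 0 j = conjc (A 0 j).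
Proof. by rewrite mxE. Qed.

Lemma wirtE e F p j : csmooth_on U F -> U p ->
  wirt e F p 0 j = wder e (fun q => F q 0 j) p.
Proof.
move=> sF Up; rewrite /wder -(cderiveE (1, 0) j sF Up) -(cderiveE (0, 1) j sF Up).
by rewrite unlock; move: (cderive _ _ _) (cderive _ _ _) => A B; rewrite !mxE.
Qed.

Lemma csmooth_wirt e F : csmooth_on U F -> csmooth_on U (wirt e F).
Proof.
move=> sF; have /csmooth_onP sF' := sF; apply/csmooth_onP => j.
by apply: eq_csm (csm_wder oU e (sF' j)) => // p Up; rewrite wirtE.
Qed.

Lemma eq_wirt e F G p : (forall q, U q -> F q = G q) -> U p ->
  wirt e F p = wirt e G p.
Proof.
move=> FG Up.
have Er v : 'D_v (fun q => re_row (F q)) p = 'D_v (fun q => re_row (G q)) p.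
  by apply: (eq_on_derive oU) => // q /FG ->.
have Ei v : 'D_v (fun q => im_row (F q)) p = 'D_v (fun q => im_row (G q)) p.
  by apply: (eq_on_derive oU) => // q /FG ->.
by rewrite unlock /cderive !Er !Ei.
Qed.

Lemma eq_csmooth F G : (forall q, U q -> F q = G q) -> csmooth_on U F -> csmooth_on U G.
Proof.
move=> FG [sr si]; split=> k; [move: (sr k)|move: (si k)];
  by apply: eq_on_Ck => // p /FG ->.
Qed.

Lemma csmoothD F G : csmooth_on U F -> csmooth_on U G ->
  csmooth_on U (fun p => F p + G p).
Proof.
move=> /csmooth_onP sF /csmooth_onP sG; apply/csmooth_onP => j.
by apply: eq_csm (csmD oU (sF j) (sG j)) => // p _; rewrite coordD.
Qed.

Lemma csmoothZ a F : csm U a -> csmooth_on U F -> csmooth_on U (fun p => a p *: F p).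
Proof.
move=> sa /csmooth_onP sF; apply/csmooth_onP => j.
by apply: eq_csm (csmM oU sa (sF j)) => // p _; rewrite coordZ.
Qed.

Lemma csmooth_conj F : csmooth_on U F -> csmooth_on U (fun p => conj_row (F p)).
Proof.
move=> /csmooth_onP sF; apply/csmooth_onP => j.
by apply: eq_csm (csm_conj oU (sF j)) => // p _; rewrite coord_conj.
Qed.

Lemma wirtD e F G p : csmooth_on U F -> csmooth_on U G -> U p ->
  wirt e (fun q => F q + G q) p = wirt e F p + wirt e G p.
Proof.
move=> sF sG Up; have sFG := csmoothD sF sG.
move: (sF) (sG) => /csmooth_onP sF' /csmooth_onP sG'.
apply/rowP => j.
rewrite (wirtE e j sFG Up) coordD (wirtE e j sF Up) (wirtE e j sG Up).
rewrite -(wderD oU e (sF' j) (sG' j) Up).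
by apply: (eq_wder oU) => // q _; rewrite coordD.
Qed.

Lemma wirtZ e a F p : csm U a -> csmooth_on U F -> U p ->
  wirt e (fun q => a q *: F q) p = wder e a p *: F p + a p *: wirt e F p.
Proof.
move=> sa sF Up; have saF := csmoothZ sa sF; have /csmooth_onP sF' := sF.
apply/rowP => j.
rewrite (wirtE e j saF Up) coordD (coordZ (wder e a p)) (coordZ (a p)) (wirtE e j sF Up).
rewrite -(wderM oU e sa (sF' j) Up).
by apply: (eq_wder oU) => // q _; rewrite coordZ.
Qed.

Lemma wirt_conj e F p : csmooth_on U F -> U p ->
  wirt e (fun q => conj_row (F q)) p = conj_row (wirt (conjc e) F p).
Proof.
move=> sF Up; have sJ := csmooth_conj sF; have /csmooth_onP sF' := sF.
apply/rowP => j.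
rewrite (wirtE e j sJ Up) coord_conj (wirtE _ j sF Up) -(wder_conj oU e (sF' j) Up).
by apply: (eq_wder oU) => // q _; rewrite coord_conj.
Qed.

Lemma wirt_comm e e' F p : csmooth_on U F -> U p ->
  wirt e (wirt e' F) p = wirt e' (wirt e F) p.
Proof.
move=> sF Up; have /csmooth_onP sF' := sF.
have s1 := csmooth_wirt e sF; have s2 := csmooth_wirt e' sF.
apply/rowP => j; rewrite (wirtE e j s2 Up) (wirtE e' j s1 Up).
transitivity (wder e (wder e' (fun q => F q 0 j)) p).
  by apply: (eq_wder oU) => // q Uq; rewrite (wirtE e' j sF Uq).
rewrite (wder_comm oU e e' (sF' j) Up).
by apply: (eq_wder oU) => // q Uq; rewrite (wirtE e j sF Uq).
Qed.

End Rows.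

Lemma dot_csm n (F G : R * R -> 'rV[C]_n) : csmooth_on U F -> csmooth_on U G ->
  csm U (fun p => dot (F p) (G p)).
Proof.
move=> /csmooth_onP sF /csmooth_onP sG.
by apply: (csm_sum oU) => j; apply: csmM.
Qed.

Lemma wder_dot n e (F G : R * R -> 'rV[C]_n) p :
  csmooth_on U F -> csmooth_on U G -> U p ->
  wder e (fun q => dot (F q) (G q)) p = dot (wirt e F p) (G p) + dot (F p) (wirt e G p).
Proof.
move=> sF sG Up; move: (sF) (sG) => /csmooth_onP sF' /csmooth_onP sG'.
rewrite /dot (wder_sum oU)//; last by move=> i; apply: csmM.
rewrite -big_split; apply: eq_bigr => j _ /=.
by rewrite (wderM oU e (sF' j) (sG' j) Up) (wirtE e j sF Up) (wirtE e j sG Up).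
Qed.

End ComplexRows.

(** * Algebra of the Lorentz form *)

Section LorentzForm.
Variables (K : comPzRingType) (n : nat).
Implicit Types (x y z : 'rV[K]_(1 + n)) (a : K).

(** Reduces the Leibniz rule for [lorentz] to that for [dot], since the matrix factor is
    constant. *)
Lemma lorentz_dot x y : lorentz x y = dot (x *m lorentz_mx K n) y.
Proof. by rewrite /lorentz /dot [LHS]mxE; apply: eq_bigr => j _; rewrite [y^T _ _]mxE. Qed.

Lemma lorentz_row_mx a b (x y : 'rV[K]_n) :
  lorentz (row_mx a%:M x) (row_mx b%:M y) = dot x y - a * b.
Proof.
rewrite /lorentz mul_row_block tr_row_mx !mulmx0 addr0 add0r mulmx1 mul_row_col.
rewrite mulmxN mulmx1 tr_scalar_mx mulNmx -scalar_mxM !mxE eqxx mulr1n addrC.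
by congr (_ - _); apply: eq_bigr => j _; rewrite mxE.
Qed.

Lemma lorentzC x y : lorentz x y = lorentz y x.
Proof.
rewrite -[x]hsubmxK -[y]hsubmxK [lsubmx x]mx11_scalar [lsubmx y]mx11_scalar.
rewrite !lorentz_row_mx mulrC; congr (_ - _).
by apply: eq_bigr => j _; rewrite mulrC.
Qed.

Lemma lorentzDl x y z : lorentz (x + y) z = lorentz x z + lorentz y z.
Proof. by rewrite /lorentz !mulmxDl mxE. Qed.

Lemma lorentzZl a x y : lorentz (a *: x) y = a * lorentz x y.
Proof. by rewrite /lorentz -!scalemxAl mxE. Qed.

Lemma lorentzDr x y z : lorentz z (x + y) = lorentz z x + lorentz z y.
Proof. by rewrite lorentzC lorentzDl !(lorentzC z). Qed.

Lemma lorentzZr a x y : lorentz x (a *: y) = a * lorentz x y.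
Proof. by rewrite lorentzC lorentzZl lorentzC. Qed.

Lemma map_lorentz (L : comPzRingType) (c : {rmorphism K -> L}) x y :
  lorentz (map_mx c x) (map_mx c y) = c (lorentz x y).
Proof.
have E : map_mx c (lorentz_mx K n) = lorentz_mx L n.
  by rewrite /lorentz_mx map_block_mx !map_mx0 map_mxN !map_mx1.
by rewrite /lorentz map_trmx -E -!map_mxM mxE.
Qed.

End LorentzForm.

(** * Conjugation, real and imaginary parts of rows *)

Section Conjugation.
Variable R : realType.
Local Notation C := R[i].

Lemma conj_rowD n (x y : 'rV[C]_n) : conj_row (x + y) = conj_row x + conj_row y.
Proof. exact: map_mxD. Qed.

Lemma conj_rowZ n (a : C) (x : 'rV[C]_n) : conj_row (a *: x) = conjc a *: conj_row x.
Proof. exact: map_mxZ. Qed.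

Lemma conj_rowK n (x : 'rV[C]_n) : conj_row (conj_row x) = x.
Proof. by apply/rowP => j; rewrite !mxE conjcK. Qed.

Lemma conj_cplx_row n (x : 'rV[R]_n) : conj_row (cplx_row x) = cplx_row x.
Proof. by apply/rowP => j; rewrite !mxE conjc_real. Qed.

Lemma row_re_im n (x : 'rV[C]_n) : x = cplx_row (re_row x) + 'i%C *: cplx_row (im_row x).
Proof. by apply/rowP => j; rewrite !mxE -complexE. Qed.

Lemma conj_row_re_im n (x : 'rV[C]_n) :
  conj_row x = cplx_row (re_row x) - 'i%C *: cplx_row (im_row x).
Proof.
rewrite {1}(row_re_im x) conj_rowD conj_rowZ !conj_cplx_row -scaleNr.
by congr (_ + _ *: _); apply: complex_ext; rewrite /= ?oppr0.
Qed.

Lemma conj_lorentz n (x y : 'rV[C]_(1 + n)) :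
  lorentz (conj_row x) (conj_row y) = conjc (lorentz x y).
Proof.
exact: map_lorentz.
Qed.

End Conjugation.

(* The four vectors stand for [Y], [Y_z], [Y_zbar] and [Y_z zbar] at a point;
   [normal_part] subtracts from [x] its component in their span, computed with
   the dual basis of the Gram matrix. *)
HB.lock Definition normal_part (K : numFieldType) n (Y Z B N x : 'rV[K]_(1 + n)) :
    'rV[K]_(1 + n) :=
  x + (2 * lorentz x N + 4 * lorentz N N * lorentz x Y) *: Y
    + (- 2 * lorentz x B) *: Z + (- 2 * lorentz x Z) *: B
    + (2 * lorentz x Y) *: N.

(** Conjugation exchanges Y_z and Y_zbar and fixes Y and Y_zzbar; this symmetry is what makes the
    normal part commute with it. *)
Lemma normal_partC (K : numFieldType) n (Y Z B N x : 'rV[K]_(1 + n)) :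
  normal_part Y Z B N x = normal_part Y B Z N x.
Proof. by rewrite unlock; congr (_ + _); rewrite addrAC. Qed.

Lemma normal_part_map (K L : numFieldType) (c : {rmorphism K -> L}) n
    (Y Z B N x : 'rV[K]_(1 + n)) :
  map_mx c (normal_part Y Z B N x) = normal_part (map_mx c Y) (map_mx c Z)
    (map_mx c B) (map_mx c N) (map_mx c x).
Proof.
rewrite unlock !map_mxD !map_mxZ !map_lorentz.
by rewrite !(rmorph_nat, rmorphN, rmorphD, rmorphM).
Qed.

(** * The Gram formula computes the orthogonal projection to the normal space *)

Section NormalPart.
Variables (K : numFieldType) (n : nat).
Variables (Y Z B N : 'rV[K]_(1 + n)).
Local Notation normal_part := (normal_part Y Z B N).

Lemma normal_partD x y : normal_part (x + y) = normal_part x + normal_part y.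
Proof.
by rewrite unlock !lorentzDl; apply/rowP => j; rewrite !mxE; ring.
Qed.

Lemma normal_partZ a x : normal_part (a *: x) = a *: normal_part x.
Proof.
by rewrite unlock !lorentzZl; apply/rowP => j; rewrite !mxE; ring.
Qed.

Lemma normal_part_orth x : lorentz x Y = 0 -> lorentz x Z = 0 ->
  normal_part x = x + (2 * lorentz x N) *: Y + (- 2 * lorentz x B) *: Z.
Proof. by move=> xY xZ; rewrite unlock xY xZ !mulr0 !scale0r !addr0. Qed.

Variable V : 'M[K]_(1 + n).
Let Vp : 'M[K]_(1 + n) := kermx (lorentz_mx K n *m V^T).

Hypothesis VP : forall x : 'rV[K]_(1 + n), (x <= V)%MS <->
  exists a b c d, x = a *: Y + b *: Z + c *: B + d *: N.
Hypothesis YY : lorentz Y Y = 0.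
Hypothesis YZ : lorentz Y Z = 0.
Hypothesis YB : lorentz Y B = 0.
Hypothesis YN : lorentz Y N = - 2^-1.
Hypothesis ZZ : lorentz Z Z = 0.
Hypothesis ZB : lorentz Z B = 2^-1.
Hypothesis ZN : lorentz Z N = 0.
Hypothesis BB : lorentz B B = 0.
Hypothesis BN : lorentz B N = 0.

Let gram := (YY, ZZ, ZB, YZ, YN, ZN, YB, BB, BN, lorentzC Z Y, lorentzC N Y,
  lorentzC B Y, lorentzC B Z, lorentzC N Z, lorentzC N B).

Lemma normalP x : (x <= Vp)%MS <->
  [/\ lorentz x Y = 0, lorentz x Z = 0, lorentz x B = 0 & lorentz x N = 0].
Proof.
have VpE : (x <= Vp)%MS <-> (forall v, (v <= V)%MS -> lorentz x v = 0).
  split=> [/sub_kermxP xV v /submxP[w ->]|xV].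
    by rewrite /lorentz trmx_mul mulmxA -(mulmxA x) xV mul0mx mxE.
  apply/sub_kermxP/rowP => j; rewrite mulmxA [RHS]mxE.
  by have := xV _ (row_sub j V); rewrite /lorentz tr_row colE mulmxA -colE mxE.
split=> [/VpE xV|[xY xZ xB xN]].
  split; apply: xV; apply/VP.
  - by exists 1, 0, 0, 0; rewrite !scale0r !addr0 scale1r.
  - by exists 0, 1, 0, 0; rewrite !scale0r !addr0 scale1r add0r.
  - by exists 0, 0, 1, 0; rewrite !scale0r !addr0 scale1r !add0r.
  - by exists 0, 0, 0, 1; rewrite !scale0r scale1r !add0r.
apply/VpE => v /VP[a [b [c [d ->]]]].
by rewrite !lorentzDr !lorentzZr xY xZ xB xN !mulr0 !addr0.
Qed.

Lemma normal_part_normal x : (normal_part x <= Vp)%MS.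
Proof.
by apply/normalP; split; rewrite unlock !(lorentzDl, lorentzZl) !gram; field.
Qed.

Lemma normal_part_id x : (x <= Vp)%MS -> normal_part x = x.
Proof.
move=> /normalP[xY xZ xB xN].
by rewrite normal_part_orth// xB xN !mulr0 !scale0r !addr0.
Qed.

Lemma normal_part_basis : [/\ normal_part Y = 0, normal_part Z = 0,
  normal_part B = 0 & normal_part N = 0].
Proof.
by split; rewrite unlock !gram; apply/rowP => j; rewrite !mxE; field.
Qed.

(** A projection is determined by its values on two complementary summands: [normal_part x] lies in
    [Vp], and the remainder is an explicit combination of the four spanning vectors. *)
Lemma proj_normal_part x : x *m proj_mx Vp V = normal_part x.
Proof.
(* On a common vector [normal_part] is both the identity, by normality, and zero, by tangency. *)
have cap0 : (Vp :&: V = 0)%MS.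
  apply/eqP; rewrite -submx0; apply/rV_subP => v.
  rewrite sub_capmx => /andP[vp /VP[a [b [c [d vE]]]]].
  have := normal_part_id vp; rewrite {1}vE !(normal_partD, normal_partZ).
  have [-> -> -> ->] := normal_part_basis.
  by rewrite !scaler0 !addr0 => <-; rewrite sub0mx.
have xE : x = normal_part x + (x - normal_part x) by rewrite addrC subrK.
rewrite {1}xE mulmxDl proj_mx_id ?normal_part_normal// proj_mx_0 ?addr0//.
apply/VP.
exists (- (2 * lorentz x N + 4 * lorentz N N * lorentz x Y)), (2 * lorentz x B),
  (2 * lorentz x Z), (- (2 * lorentz x Y)).
by rewrite unlock; apply/rowP => j; rewrite !mxE; ring.
Qed.

End NormalPart.

Lemma normal_part_conj (R : realType) n (Y Z N x : 'rV[R[i]]_(1 + n)) :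
  conj_row Y = Y -> conj_row N = N ->
  normal_part Y Z (conj_row Z) N (conj_row x)
    = conj_row (normal_part Y Z (conj_row Z) N x).
Proof.
move=> conjY conjN.
rewrite normal_partC -{1}conjY -{2}[Z]conj_rowK -{1}conjN.
by rewrite [RHS](normal_part_map (@conjc R)).
Qed.

(** Over the complex numbers Re Z and Im Z span the same space as Z and its conjugate, in which the
    Gram matrix takes its simple form. *)
Lemma tangent_spanP (R : realType) n (Y Z N x : 'rV[R[i]]_(1 + n)) :
  (x <= Y + cplx_row (re_row Z) + cplx_row (im_row Z) + N)%MS <->
  exists a b c d, x = a *: Y + b *: Z + c *: conj_row Z + d *: N.
Proof.
have rE : cplx_row (re_row Z) = 2^-1 *: (Z + conj_row Z).
  by apply/rowP => j; rewrite !mxE [LHS]ReJ_add mulrC.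
have iE : cplx_row (im_row Z) = ('i%C / 2) *: (conj_row Z - Z).
  by apply/rowP => j; rewrite !mxE [LHS]ImJ_sub; ring.
set V := (Y + _ + _ + _)%MS.
have Zri := row_re_im Z; have Bri := conj_row_re_im Z.
set r := cplx_row _ in rE Zri Bri; set i := cplx_row _ in iE Zri Bri.
split=> [/sub_addsmxP[[u1 u2] /= ->]|[a [b [c [d ->]]]]]; last first.
  have YV : (Y <= V)%MS.
    exact: submx_trans (addsmxSl _ _) (submx_trans (addsmxSl _ _) (addsmxSl _ _)).
  have rV : (r <= V)%MS.
    exact: submx_trans (addsmxSr _ _) (submx_trans (addsmxSl _ _) (addsmxSl _ _)).
  have iV : (i <= V)%MS by exact: submx_trans (addsmxSr _ _) (addsmxSl _ _).
  rewrite !addmx_sub// scalemx_sub//.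
  - by rewrite Zri addmx_sub ?scalemx_sub.
  - by rewrite Bri addmx_sub ?eqmx_opp ?scalemx_sub.
  exact: addsmxSr.
have /sub_addsmxP[[v1 v2] /= E1] := submxMl u1 ((Y + r) + i)%MS.
have /sub_addsmxP[[w1 w2] /= E2] := submxMl v1 (Y + r)%MS.
rewrite E1 E2 (mx11_scalar w1) (mx11_scalar w2) (mx11_scalar v2) (mx11_scalar u2).
rewrite !mul_scalar_mx rE iE.
move: (w1 _ _) (w2 _ _) (v2 _ _) (u2 _ _) => a b c d.
exists a, (b / 2 - c * ('i%C / 2)), (b / 2 + c * ('i%C / 2)), d.
rewrite !scalerA scalerDr scalerBr scalerBl scalerDl.
by congr (_ + _); rewrite -!addrA; congr (_ + (_ + _)); rewrite [RHS]addrC addrA.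
Qed.

(** * Leibniz rule for the Lorentz form *)

Section LorentzCalculus.
Variables (R : realType) (U : set (R * R)).
Hypothesis oU : open U.
Local Notation C := R[i].

Lemma csmooth_mulmx n m (F : R * R -> 'rV[C]_n) (A : 'M[C]_(n, m)) :
  csmooth_on U F -> csmooth_on U (fun p => F p *m A).
Proof.
move=> /csmooth_onP - /(_ oU) sF; apply/(csmooth_onP oU) => j.
apply: (@eq_csm _ _ oU (fun p => \sum_k F p 0 k * A k j)).
  by move=> p _; rewrite mxE.
by apply: (csm_sum oU) => k; apply: (csmM oU) => //; exact: csm_cst.
Qed.

Lemma wirt_mulmx n m e (F : R * R -> 'rV[C]_n) (A : 'M[C]_(n, m)) p :
  csmooth_on U F -> U p -> wirt e (fun q => F q *m A) p = wirt e F p *m A.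
Proof.
move=> sF Up; have sFA := csmooth_mulmx A sF; have /(csmooth_onP oU) sF' := sF.
have sc k j := csm_cst oU (A k j).
apply/rowP => j; rewrite (wirtE e j sFA Up) [RHS]mxE.
rewrite (@eq_wder _ _ oU _ _ (fun q => \sum_k F q 0 k * A k j))//; last first.
  by move=> q _; rewrite mxE.
rewrite (wder_sum oU)//; last by move=> k; exact: (csmM oU).
apply: eq_bigr => k _.
by rewrite (wderM oU e (sF' k) (sc k j) Up) wder_cst mulr0 addr0 (wirtE e k sF Up).
Qed.

Section Leibniz.
Variable n : nat.
Implicit Types F G : R * R -> 'rV[C]_(1 + n).

Lemma csm_lorentz F G : csmooth_on U F -> csmooth_on U G ->
  csm U (fun p => lorentz (F p) (G p)).
Proof.
move=> sF sG; apply: eq_csm (dot_csm oU (csmooth_mulmx (lorentz_mx C n) sF) sG) => //.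
by move=> p _; rewrite lorentz_dot.
Qed.

Lemma wder_lorentz e F G p : csmooth_on U F -> csmooth_on U G -> U p ->
  wder e (fun q => lorentz (F q) (G q)) p
    = lorentz (wirt e F p) (G p) + lorentz (F p) (wirt e G p).
Proof.
move=> sF sG Up; have sFM := csmooth_mulmx (lorentz_mx C n) sF.
rewrite (eq_wder oU e (fun q _ => lorentz_dot (F q) (G q)) Up).
by rewrite (wder_dot oU e sFM sG Up) wirt_mulmx// -!lorentz_dot.
Qed.

Lemma lorentz_wirtN e F G (c : C) p : csmooth_on U F -> csmooth_on U G ->
  (forall q, U q -> lorentz (F q) (G q) = c) -> U p ->
  lorentz (wirt e F p) (G p) = - lorentz (F p) (wirt e G p).
Proof.
move=> sF sG FGc Up; apply/eqP; rewrite -addr_eq0 -wder_lorentz//.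
by rewrite (eq_wder oU e FGc Up) wder_cst.
Qed.

Lemma lorentz_wirt0 e F (c : C) p : csmooth_on U F ->
  (forall q, U q -> lorentz (F q) (F q) = c) -> U p ->
  lorentz (F p) (wirt e F p) = 0.
Proof.
move=> sF FFc Up; have := lorentz_wirtN e sF sF FFc Up.
rewrite lorentzC => /eqP; rewrite -addr_eq0 -mulr2n -mulr_natl mulf_eq0 pnatr_eq0/=.
by move/eqP.
Qed.

End Leibniz.
End LorentzCalculus.

(** * Smoothness, nullity and normalisation of the canonical lift *)

Section CanonicalLift.
Variables (R : realType) (U : set (R * R)) (y : R * R -> 'rV[R]_7).
Hypothesis oU : open U.
Hypothesis ciy : conformal_immersion U y.
Local Notation C := R[i].
Local Notation ii := ('i%C : C).

Let yC p := cplx_row (y p).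

Lemma csmooth_cplx n (G : R * R -> 'rV[R]_n) :
  smooth_on U G -> csmooth_on U (fun p => cplx_row (G p)).
Proof.
move=> sG; apply/(csmooth_onP oU) => j.
apply: eq_csm (csm_real oU (smooth_coord oU j sG)) => // p _.
by rewrite mxE.
Qed.

Let syC : csmooth_on U yC.
Proof. exact: csmooth_cplx (ci_smooth ciy). Qed.

Lemma conj_dz_cplx n (G : R * R -> 'rV[R]_n) e p : smooth_on U G -> U p ->
  conj_row (wirt e (fun q => cplx_row (G q)) p)
    = wirt (conjc e) (fun q => cplx_row (G q)) p.
Proof.
move=> sG Up; have sC := csmooth_cplx sG.
rewrite -[e in LHS]conjcK -(wirt_conj oU _ sC Up).
by apply: (eq_wirt oU) => // q _; rewrite conj_cplx_row.
Qed.

Let conj_dz_yC p : U p -> conj_row (wirt (- ii) yC p) = wirt ii yC p.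
Proof.
move=> Up; rewrite (conj_dz_cplx _ (ci_smooth ciy) Up).
by congr (wirt _ _ _); apply: complex_ext; rewrite /= ?oppr0 ?opprK.
Qed.

Lemma dot_conj_ge0 n (x : 'rV[C]_n) : 0 <= dot x (conj_row x).
Proof. by apply: sumr_ge0 => j _; rewrite mxE mulcJ_ge0. Qed.

Lemma dot_conj_eq0 n (x : 'rV[C]_n) : dot x (conj_row x) = 0 -> x = 0.
Proof.
move=> /eqP; rewrite psumr_eq0 => [/allP xx|j _]; last by rewrite mxE mulcJ_ge0.
apply/rowP => j; have := xx j (mem_index_enum j).
by rewrite !mxE mulf_eq0 conjc_eq0 orbb => /eqP.
Qed.

(** The real part of 2 y_z is y_u, which cannot vanish because the rows y_u, y_v are independent. *)
Let dz_yC_neq0 p : U p -> wirt (- ii) yC p != 0.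
Proof.
move=> Up; apply/eqP => dy0.
have dr j : 'D_(1, 0) y p 0 j = 0.
  have := wirtE (- ii) j syC Up; rewrite dy0 mxE /wder.
  have E v : cD v (fun q => yC q 0 j) p = ('D_v (fun q => y q 0 j) p)%:C.
    rewrite /cD; apply: complex_ext => /=.
      by congr ('D_v _ p); apply/funext => q; rewrite mxE.
    rewrite -[RHS](derive_cst (0 : R) p v).
    by congr ('D_v _ p); apply/funext => q; rewrite mxE.
  rewrite !E derive_mx; last exact: smooth_derivable (ci_smooth ciy) Up.
  rewrite mxE; move: ('D__ _ p) ('D__ _ p) => a b /esym/eqP.
  rewrite mulf_eq0 invr_eq0 pnatr_eq0/= => /eqP/(congr1 (@complex.Re R)) /=.
  by rewrite oppr0 mul0r mulr0 subr0 addr0.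
have := ci_immersion ciy Up => /row_freeP[A].
have -> : 'D_((1, 0) : R * R) y p = 0 by apply/rowP => j; rewrite dr mxE.
rewrite mul_col_mx mul0mx => /matrixP /(_ (lshift 1 0) (lshift 1 0)).
rewrite col_mxEu !mxE eqxx => /esym/eqP; by rewrite oner_eq0.
Qed.

Let g p : R := complex.Re (2 * dot (dz yC p) (dzbar yC p)).

(** Since y is real, y_zbar is the conjugate of y_z, and the product is twice the squared Hermitian
    norm of a nonzero vector. Positivity puts the logarithm in [omega] in its proper domain. *)
Let gE p : U p -> 0 < g p /\ (g p)%:C = 2 * dot (wirt (- ii) yC p) (wirt ii yC p).
Proof.
move=> Up; rewrite /g dz_wirt dzbar_wirt -conj_dz_yC//.
set x := wirt _ _ _.
have x0 : 0 < 2 * dot x (conj_row x).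
  rewrite mulr_gt0 ?ltr0n// lt_neqAle dot_conj_ge0 andbT eq_sym.
  by apply: contra (dz_yC_neq0 Up) => /eqP/dot_conj_eq0 /eqP.
have := x0; rewrite ltcE => /andP[/eqP im0 re0]; split=> //.
by apply: complex_ext => //=; rewrite im0.
Qed.

Let sg : smooth_on U g.
Proof.
have s2 : csm U (fun=> 2 : C) by exact: csm_cst.
have := csmM oU s2 (dot_csm oU (csmooth_wirt oU (- ii) syC) (csmooth_wirt oU ii syC)).
by move=> [sr _] k; apply: eq_on_Ck (sr k) => // p _; rewrite /g dz_wirt dzbar_wirt.
Qed.

Let f p : C := (rsqrt (g p))%:C.
Let sf : csm U f.
Proof.
by apply: csm_real => // k; apply: (Ck_rsqrt oU _ (sg k)) => p /gE[].
Qed.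

Let Nl p : 'rV[C]_(1 + 7) := row_mx 1%:M (yC p).

Let liftE : canonical_lift y = fun p => f p *: Nl p.
Proof.
apply/funext => p; rewrite /canonical_lift /lift_real /cplx_row map_mxZ map_row_mx.
by rewrite map_mx1.
Qed.

Let sN : csmooth_on U Nl.
Proof.
apply/(csmooth_onP oU) => j; rewrite /Nl -(splitK j); case: (fintype.split j) => k /=.
  apply: (@eq_csm _ _ oU (fun=> (1%:M : 'M[C]_1) 0 k)); last exact: csm_cst.
  by move=> p _; rewrite row_mxEl.
apply: (@eq_csm _ _ oU (fun p => yC p 0 k)); last by have /(csmooth_onP oU) := syC.
by move=> p _; rewrite row_mxEr.
Qed.

Let wirt_N e p : U p -> wirt e Nl p = row_mx 0%:M (wirt e yC p).
Proof.
move=> Up; apply/rowP => j; rewrite (wirtE e j sN Up) /Nl.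
rewrite -(splitK j); case: (fintype.split j) => k /=.
  rewrite row_mxEl (@eq_wder _ _ oU e _ (fun=> (1%:M : 'M[C]_1) 0 k))//.
    by rewrite wder_cst !mxE mul0rn.
  by move=> q _; rewrite row_mxEl.
rewrite row_mxEr (wirtE e k syC Up); apply: (eq_wder oU) => // q _.
by rewrite row_mxEr.
Qed.

Let NN p : U p -> lorentz (Nl p) (Nl p) = 0.
Proof.
move=> Up; rewrite /Nl lorentz_row_mx mulr1.
have -> : dot (yC p) (yC p) = (dot (y p) (y p))%:C.
  by rewrite /dot rmorph_sum; apply: eq_bigr => j _; rewrite !mxE rmorphM.
by rewrite (ci_sphere ciy Up) subrr.
Qed.

Lemma csmooth_lift : csmooth_on U (canonical_lift y).
Proof. by rewrite liftE; exact: csmoothZ. Qed.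

Lemma conj_lift p : conj_row (canonical_lift y p) = canonical_lift y p.
Proof. exact: conj_cplx_row. Qed.

Lemma lift_null p : U p -> lorentz (canonical_lift y p) (canonical_lift y p) = 0.
Proof. by move=> Up; rewrite liftE lorentzZl lorentzZr NN// !mulr0. Qed.

(** With Y = f (1, y), every term in which f is differentiated contains <Nl, Nl> or its derivative
    and vanishes. What remains is f^2 <y_z, y_zbar>, where f^2 = e^(-2 omega) and <y_z, y_zbar> =
    e^(2 omega) / 2. *)
Lemma lift_normalized p : U p ->
  lorentz (wirt (- ii) (canonical_lift y) p) (wirt ii (canonical_lift y) p) = 2^-1.
Proof.
move=> Up; rewrite liftE !(wirtZ oU _ sf sN Up).
rewrite !(lorentzDl, lorentzDr, lorentzZl, lorentzZr) NN//.
rewrite (lorentz_wirt0 oU ii sN NN Up) lorentzC (lorentz_wirt0 oU (- ii) sN NN Up).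
rewrite !wirt_N// lorentz_row_mx !mulr0 subr0 !add0r mulrA.
have [g0 gd] := gE Up.
apply: (mulfI (_ : (2 : C) != 0)); first by rewrite pnatr_eq0.
rewrite mulrCA -gd mulfV ?pnatr_eq0// -expr2 -rmorphXn -rmorphM.
by rewrite rsqrt_sqr// .
Qed.

End CanonicalLift.

(** * Moving frame of a real null lift, Codazzi equation and Willmore equation *)

Section NullLift.
Local Opaque lorentz.
Variables (R : realType) (U : set (R * R)) (n : nat).
Hypothesis oU : open U.
Local Notation C := R[i].
Local Notation ii := ('i%C : C).
Local Notation field := (R * R -> 'rV[C]_(1 + n)).

Let conj_i : conjc ii = - ii.
Proof. by apply: complex_ext; rewrite /= ?oppr0. Qed.
Let conj_Ni : conjc (- ii) = ii.
Proof. by rewrite -conj_i conjcK. Qed.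

Lemma conj_wirt_real e (F : field) p : csmooth_on U F ->
  (forall q, U q -> conj_row (F q) = F q) -> U p ->
  conj_row (wirt e F p) = wirt (conjc e) F p.
Proof.
move=> sF FF Up; rewrite -[e in LHS]conjcK -(wirt_conj oU _ sF Up).
exact: (eq_wirt oU).
Qed.

(** Conjugation swaps the two Wirtinger derivatives of a real field, and these commute. The lemma
    serves for Y and again for the real field Y_zzbar. *)
Lemma conj_laplacian (F : field) p : csmooth_on U F ->
  (forall q, U q -> conj_row (F q) = F q) -> U p ->
  conj_row (wirt ii (wirt (- ii) F) p) = wirt ii (wirt (- ii) F) p.
Proof.
move=> sF FF Up; have sZ := csmooth_wirt oU (- ii) sF.
have := wirt_conj oU (- ii) sZ Up; rewrite conj_Ni => <-.
rewrite (wirt_comm oU ii (- ii) sF Up).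
by apply: (eq_wirt oU) => // q Uq; rewrite conj_wirt_real// conj_Ni.
Qed.

Variable Y : field.
Local Notation Z := (wirt (- ii) Y).
Local Notation B := (wirt ii Y).
Local Notation N := (wirt ii (wirt (- ii) Y)).
Hypothesis sY : csmooth_on U Y.
Hypothesis conjY : forall p, U p -> conj_row (Y p) = Y p.
Hypothesis YY : forall p, U p -> lorentz (Y p) (Y p) = 0.
Hypothesis ZZ : forall p, U p -> lorentz (Z p) (Z p) = 0.
Hypothesis ZB : forall p, U p -> lorentz (Z p) (B p) = 2^-1.

Let sZ : csmooth_on U Z. Proof. exact: csmooth_wirt. Qed.
Let sB : csmooth_on U B. Proof. exact: csmooth_wirt. Qed.
Let sN : csmooth_on U N. Proof. exact: csmooth_wirt. Qed.

Let conjZ p : U p -> conj_row (Z p) = B p.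
Proof. by move=> Up; rewrite (conj_wirt_real _ sY conjY Up) conj_Ni. Qed.
Let conjN p : U p -> conj_row (N p) = N p.
Proof. exact: conj_laplacian. Qed.

Lemma lorentz_lift_dz p : U p -> lorentz (Y p) (Z p) = 0.
Proof. exact: (lorentz_wirt0 oU _ sY YY). Qed.
Let YZ := lorentz_lift_dz.
Lemma lorentz_lift_dzbar p : U p -> lorentz (Y p) (B p) = 0.
Proof. exact: (lorentz_wirt0 oU _ sY YY). Qed.
Let YB := lorentz_lift_dzbar.
Lemma lorentz_lift_laplacian p : U p -> lorentz (Y p) (N p) = - 2^-1.
Proof.
move=> Up; rewrite -[LHS]opprK -(lorentz_wirtN oU ii sY sZ YZ Up).
by rewrite lorentzC ZB.
Qed.
Let YN := lorentz_lift_laplacian.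
Lemma lorentz_dz_laplacian p : U p -> lorentz (Z p) (N p) = 0.
Proof. exact: (lorentz_wirt0 oU _ sZ ZZ). Qed.
Let ZN := lorentz_dz_laplacian.
Lemma lorentz_dzbar_dzbar p : U p -> lorentz (B p) (B p) = 0.
Proof. by move=> Up; rewrite -conjZ// conj_lorentz ZZ// conjc0. Qed.
Let BB := lorentz_dzbar_dzbar.
Lemma lorentz_dzbar_laplacian p : U p -> lorentz (B p) (N p) = 0.
Proof. by move=> Up; rewrite -conjZ// -(conjN Up) conj_lorentz ZN// conjc0. Qed.
Let BN := lorentz_dzbar_laplacian.

Let V p : 'M[C]_(1 + n) :=
  (Y p + cplx_row (re_row (Z p)) + cplx_row (im_row (Z p)) + N p)%MS.
Let Vp p : 'M[C]_(1 + n) := kermx (lorentz_mx C n *m (V p)^T).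
Let P p (x : 'rV[C]_(1 + n)) := x *m proj_mx (Vp p) (V p).

Let VP p : U p -> forall x : 'rV[C]_(1 + n), (x <= V p)%MS <->
  exists a b c d, x = a *: Y p + b *: Z p + c *: B p + d *: N p.
Proof. by move=> Up x; rewrite -conjZ//; exact: tangent_spanP. Qed.

Let PE p (x : 'rV[C]_(1 + n)) : U p -> P p x = normal_part (Y p) (Z p) (B p) (N p) x.
Proof.
by move=> Up; apply: proj_normal_part;
  [exact: VP|exact: YY|exact: YZ|exact: YB|exact: YN|exact: ZZ|exact: ZB
  |exact: ZN|exact: BB|exact: BN].
Qed.

Let perpP p x : U p -> (x <= Vp p)%MS ->
  [/\ lorentz x (Y p) = 0, lorentz x (Z p) = 0, lorentz x (B p) = 0
    & lorentz x (N p) = 0].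
Proof. by move=> Up; have [h _] := normalP (VP Up) x; exact: h. Qed.

Let perpPr p x : U p -> lorentz x (Y p) = 0 -> lorentz x (Z p) = 0 ->
  lorentz x (B p) = 0 -> lorentz x (N p) = 0 -> (x <= Vp p)%MS.
Proof. by move=> Up xY xZ xB xN; have [_ h] := normalP (VP Up) x; exact: h (And4 xY xZ xB xN). Qed.

Let P_id p x : U p -> (x <= Vp p)%MS -> P p x = x.
Proof.
move=> Up xV; rewrite PE//.
by apply: (normal_part_id (VP Up)).
Qed.

Let P_basis p : U p -> [/\ P p (Y p) = 0, P p (Z p) = 0, P p (B p) = 0 & P p (N p) = 0].
Proof.
by move=> Up; rewrite !PE//; apply: normal_part_basis;
  [exact: YY|exact: YZ|exact: YB|exact: YN|exact: ZZ|exact: ZB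
  |exact: ZN|exact: BB|exact: BN].
Qed.

Let PD p a b : P p (a + b) = P p a + P p b. Proof. exact: mulmxDl. Qed.
Let PZ p c a : P p (c *: a) = c *: P p a. Proof. by rewrite /P -scalemxAl. Qed.

Let P_span p x a b c d : U p ->
  P p (x + (a *: Y p + b *: B p) + (c *: Z p + d *: N p)) = P p x.
Proof.
by move=> /P_basis[PY PZ0 PB PN]; rewrite !PD !PZ PY PZ0 PB PN !scaler0 !addr0.
Qed.

Let P_conj p x : U p -> P p (conj_row x) = conj_row (P p x).
Proof. by move=> Up; rewrite !PE// -conjZ// normal_part_conj ?conjY ?conjN. Qed.

Let Db (psi : field) p := P p (wirt ii psi p).

Variables (kappa : field) (s : R * R -> C).
Hypothesis sk : csmooth_on U kappa.
Hypothesis kV : forall p, U p -> (kappa p <= Vp p)%MS.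
Hypothesis hopfE : forall p, U p -> wirt (- ii) Z p = - (s p / 2) *: Y p + kappa p.

Let sKb : csmooth_on U (wirt ii kappa). Proof. exact: csmooth_wirt. Qed.

Let al p : C := 2 * lorentz (wirt ii kappa p) (N p).
Let be p : C := - 2 * lorentz (wirt ii kappa p) (B p).

Let sal : csm U al.
Proof. by apply: (csmM oU); [exact: csm_cst|exact: csm_lorentz]. Qed.
Let sbe : csm U be.
Proof. by apply: (csmM oU); [exact: csm_cst|exact: csm_lorentz]. Qed.

(** Differentiating <kappa, Y> = <kappa, Y_z> = 0 shows kappa_zbar orthogonal to Y and Y_z, since
    kappa is orthogonal to Y_zbar and Y_zzbar. Of the four corrections in [normal_part] only those
    along Y and Y_z survive. *)
Let DbE p : U p -> Db kappa p = wirt ii kappa p + al p *: Y p + be p *: Z p.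
Proof.
move=> Up.
have kY q : U q -> lorentz (kappa q) (Y q) = 0.
  by move=> Uq; have [-> _ _ _] := perpP Uq (kV Uq).
have kZ q : U q -> lorentz (kappa q) (Z q) = 0.
  by move=> Uq; have [_ -> _ _] := perpP Uq (kV Uq).
have [_ _ kB kN] := perpP Up (kV Up).
have xY : lorentz (wirt ii kappa p) (Y p) = 0.
  by rewrite (lorentz_wirtN oU ii sk sY kY Up) kB oppr0.
have xZ : lorentz (wirt ii kappa p) (Z p) = 0.
  by rewrite (lorentz_wirtN oU ii sk sZ kZ Up) kN oppr0.
(* The corrected vector is normal, hence fixed by the projection, which kills Y and Y_z; so it is
   the projection of kappa_zbar. *)
set w := _ + _; have wV : (w <= Vp p)%MS.
  have two (c : C) : 2 * c / 2 = c by rewrite mulrC mulKf ?pnatr_eq0.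
  have wE v : lorentz w v = lorentz (wirt ii kappa p) v + al p * lorentz (Y p) v
      + be p * lorentz (Z p) v by rewrite !lorentzDl !lorentzZl.
  apply: (perpPr Up).
  - by rewrite wE xY (YY Up) [lorentz (Z p) _]lorentzC (YZ Up) !mulr0 !addr0.
  - by rewrite wE xZ (YZ Up) (ZZ Up) !mulr0 !addr0.
  - by rewrite wE (YB Up) (ZB Up) mulr0 addr0 /be !mulNr two subrr.
  - by rewrite wE (YN Up) (ZN Up) mulr0 addr0 mulrN /al two subrr.
have [PY PZ0 _ _] := P_basis Up.
by rewrite -[RHS](P_id Up wV) /w !PD !PZ PY PZ0 !scaler0 !addr0.
Qed.

Let sDb : csmooth_on U (Db kappa).
Proof.
apply: (@eq_csmooth _ _ oU _ (fun p => wirt ii kappa p + al p *: Y p + be p *: Z p)).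
  by move=> p Up; rewrite DbE.
apply: (csmoothD oU); last exact: csmoothZ.
by apply: (csmoothD oU) => //; exact: csmoothZ.
Qed.

(** The zbar-derivatives of the corrections along Y and Y_z involve only Y, Y_zbar, Y_z and Y_zzbar,
    so they project to zero. A correction along Y_zbar would have contributed the normal part of
    Y_zbarzbar. *)
Let Db2E p : U p -> Db (Db kappa) p = P p (wirt ii (wirt ii kappa) p).
Proof.
move=> Up; have s1 := csmoothZ oU sal sY; have s2 := csmoothZ oU sbe sZ.
rewrite {1}/Db (eq_wirt oU _ DbE Up).
rewrite (wirtD oU _ (csmoothD oU sKb s1) s2 Up) (wirtD oU _ sKb s1 Up).
rewrite (wirtZ oU _ sal sY Up) (wirtZ oU _ sbe sZ Up).
exact: P_span.
Qed.

(** A manifestly smooth expression for s / 2: pairing the structure equation of Y_zz with Y_zzbar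
    isolates the coefficient of Y, because <Y, Y_zzbar> = -1/2. *)
Let sg p : C := 2 * lorentz (wirt (- ii) Z p) (N p).

Let ssg : csm U sg.
Proof.
apply: (csmM oU); first exact: csm_cst.
by apply: csm_lorentz => //; exact: csmooth_wirt.
Qed.

Let sgE p : U p -> sg p = s p / 2.
Proof.
move=> Up; rewrite /sg hopfE// lorentzDl lorentzZl YN//.
have [_ _ _ ->] := perpP Up (kV Up).
by rewrite addr0 mulrNN mulrC divfK ?pnatr_eq0.
Qed.

Let kappaE p : U p -> kappa p = wirt (- ii) Z p + sg p *: Y p.
Proof. by move=> Up; rewrite hopfE// sgE// scaleNr addrAC addNr add0r. Qed.

(* The conformal Codazzi equation: up to tangential terms [D_zbar D_zbar kappa]
   is the normal part of the real vector [Y_zzzbarzbar] plus [s / 2] times the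
   conjugate of [kappa]. *)
Let codazzi p : U p ->
  let W := Db (Db kappa) p + conjc (sg p) *: kappa p in
  conj_row W = W.
Proof.
move=> Up /=; have [PY PZ0 PB PN] := P_basis Up.
have sZz := csmooth_wirt oU (- ii) sZ; have sZzb := csmooth_wirt oU ii sZz.
have ssgY := csmoothZ oU ssg sY; have ssgB := csmoothZ oU ssg sB.
have ssg' := csm_wder oU ii ssg; have ssgY' := csmoothZ oU ssg' sY.
have kb q : U q -> wirt ii kappa q
    = wirt ii (wirt (- ii) Z) q + (wder ii sg q *: Y q + sg q *: B q).
  move=> Uq; rewrite (eq_wirt oU _ kappaE Uq) (wirtD oU _ sZz ssgY Uq).
  by rewrite (wirtZ oU _ ssg sY Uq).
(* Y_zbarzbar is the conjugate of Y_zz, whose component along Y is projected away. *)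
have PBb : P p (wirt ii B p) = conj_row (kappa p).
  have -> : wirt ii B p = conj_row (wirt (- ii) Z p).
    have := wirt_conj oU ii sZ Up; rewrite conj_i => <-.
    by apply: (eq_wirt oU) => // q Uq; rewrite conjZ.
  by rewrite P_conj// hopfE// PD PZ PY scaler0 add0r P_id// kV.
(* After commuting derivatives, Y_zzzbarzbar is the mixed second derivative of the real field
   Y_zzbar. *)
have Tr : conj_row (wirt ii (wirt ii (wirt (- ii) Z)) p)
    = wirt ii (wirt ii (wirt (- ii) Z)) p.
  have E : wirt ii (wirt ii (wirt (- ii) Z)) p = wirt ii (wirt (- ii) N) p.
    by apply: (eq_wirt oU) => // q Uq; rewrite (wirt_comm oU _ _ sZ Uq).
  by rewrite E conj_laplacian.
rewrite Db2E// (eq_wirt oU _ kb Up).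
rewrite (wirtD oU _ sZzb (csmoothD oU ssgY' ssgB) Up) (wirtD oU _ ssgY' ssgB Up).
rewrite (wirtZ oU _ ssg' sY Up) (wirtZ oU _ ssg sB Up).
(* This is the shape left by the product rule, with [v] = Y_zbarzbar the only term besides [t] that
   may have a normal part. *)
have Pt t a b c d v : P p (t + ((a *: Y p + b *: B p) + (c *: B p + d *: v)))
    = P p t + d *: P p v.
  by rewrite !PD !PZ PY PB !scaler0 !add0r.
rewrite Pt PBb.
(* The two remaining terms, [sg] times the conjugate of kappa and the conjugate of [sg] times kappa,
   are exchanged by conjugation. *)
rewrite !conj_rowD !conj_rowZ -P_conj// Tr conj_rowK conjcK -!addrA.
by congr (_ + _); rewrite addrC.
Qed.

Variable E : 'I_2 -> field.
Let span2 p : 'M[C]_(2, 1 + n) := \matrix_(i < 2) E i p.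
Hypothesis sE : forall i, csmooth_on U (E i).
Hypothesis EV : forall i p, U p -> (E i p <= Vp p)%MS.
Hypothesis kE : forall p, U p -> (kappa p <= span2 p)%MS.
Hypothesis DkE : forall p, U p -> (Db kappa p <= span2 p)%MS.
Hypothesis EE : forall i j p, U p -> lorentz (E i p) (E j p) = 0.
Hypothesis EJ : forall i j p, U p -> lorentz (E i p) (conj_row (E j p)) = (i == j)%:R.
Hypothesis DE : forall i p, U p -> (Db (E i) p <= span2 p)%MS.

Let span2P p x : (x <= span2 p)%MS <->
  exists a b, x = a *: E ord0 p + b *: E ord_max p.
Proof.
have r i : row i (span2 p) = E i p by rewrite rowK.
split=> [/submxP[w ->]|[a [b ->]]].
  have o0 : widen_ord (leqnSn 1) ord0 = ord0 by exact: val_inj.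
  by exists (w 0 ord0), (w 0 ord_max); rewrite mulmx_sum_row big_ord_recr big_ord1 !r o0.
by rewrite addmx_sub ?scalemx_sub// -r row_sub.
Qed.

Let span2_coef p x : U p -> (x <= span2 p)%MS ->
  x = lorentz x (conj_row (E ord0 p)) *: E ord0 p
      + lorentz x (conj_row (E ord_max p)) *: E ord_max p.
Proof.
move=> Up /span2P[a [b ->]].
by rewrite !lorentzDl !lorentzZl !EJ//= !mulr0 !mulr1 addr0 add0r.
Qed.

(** The unitary relations make the coefficients of [psi] Lorentz products with the conjugate frame,
    hence smooth. The product rule then leaves multiples of the E_i, which are already normal, and
    of D_zbar E_i. *)
Let Db_span2 (psi : field) p : csmooth_on U psi ->
  (forall q, U q -> (psi q <= span2 q)%MS) -> U p ->
  (Db psi p <= span2 p)%MS.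
Proof.
move=> spsi psiE Up.
have sc i : csm U (fun q => lorentz (psi q) (conj_row (E i q))).
  by apply: csm_lorentz => //; exact: csmooth_conj.
have eq_psi q (Uq : U q) := span2_coef Uq (psiE q Uq).
have s0 := csmoothZ oU (sc ord0) (sE ord0).
have s1 := csmoothZ oU (sc ord_max) (sE ord_max).
rewrite /Db (eq_wirt oU _ eq_psi Up) (wirtD oU _ s0 s1 Up).
rewrite (wirtZ oU _ (sc ord0) (sE ord0) Up) (wirtZ oU _ (sc ord_max) (sE ord_max) Up).
have PS a b c d v w v' w' : P p (a *: v + b *: w + (c *: v' + d *: w'))
    = a *: P p v + b *: P p w + (c *: P p v' + d *: P p w') by rewrite !PD !PZ.
rewrite PS.
have EiE i : (P p (E i p) <= span2 p)%MS.
  rewrite P_id ?EV//.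
  by rewrite -(_ : row i (span2 p) = E i p) ?row_sub// rowK.
by rewrite !addmx_sub// scalemx_sub//; apply: DE.
Qed.

(** For real x the coefficient <x, conj E_j> equals the conjugate of <x, E_j>, which vanishes
    because the span is isotropic. *)
Let isotropic_real_eq0 p x : U p -> (x <= span2 p)%MS -> conj_row x = x -> x = 0.
Proof.
move=> Up xE xx; rewrite (span2_coef Up xE).
have c0 j : lorentz x (conj_row (E j p)) = 0.
  rewrite -[x]xx conj_lorentz; have /span2P[a [b ->]] := xE.
  by rewrite lorentzDl !lorentzZl !EE// !mulr0 addr0 conjc0.
by rewrite !c0 !scale0r addr0.
Qed.

Lemma willmore_equation p : U p ->
  Db (Db kappa) p + (conjc (s p) / 2) *: kappa p = 0.
Proof.
move=> Up; have -> : conjc (s p) / 2 = conjc (sg p).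
  rewrite sgE// conjcM; congr (_ * _).
  by rewrite conjc_inv conjc_nat.
apply: (isotropic_real_eq0 Up); last exact: codazzi.
by rewrite addmx_sub ?scalemx_sub ?kE//; exact: Db_span2.
Qed.

End NullLift.

(** * Specialisation to the canonical lift of the surface *)

Theorem theorem2p2 (R : realType) (U : set (R * R))
    (y : R * R -> 'rV[R]_7)
    (kappa : R * R -> 'rV[R[i]]_(1 + 7)) (s : R * R -> R[i]) :
  open U -> connected U ->
  conformal_immersion U y ->
  totally_isotropic U y ->
  hopf_schwarzian U y kappa s ->
  (exists E : 'I_2 -> R * R -> 'rV[R[i]]_(1 + 7),
      isotropic_frame U y kappa E) ->
  willmore U y.
Proof.
move=> oU _ ciy tiy [[sk kV] hs] [E fE]; exists kappa, s; split=> // p Up.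
set Y := canonical_lift y in hs.
(* Total isotropy with m = n = 1. *)
have ZZ q : U q -> lorentz (wirt (- 'i%C) Y q) (wirt (- 'i%C) Y q) = 0.
  by move=> Uq; have := tiy 1%N 1%N isT isT q Uq; rewrite /= dz_wirt.
have hopfE q : U q -> wirt (- 'i%C) (wirt (- 'i%C) Y) q = - (s q / 2) *: Y q + kappa q.
  by move=> Uq; have := hs q Uq; rewrite !dz_wirt.
(* The tangent and normal fibres are rewritten through [wirt], the form in which [willmore_equation]
   expects them. *)
pose V q := (Y q + cplx_row (re_row (wirt (- 'i%C) Y q))
  + cplx_row (im_row (wirt (- 'i%C) Y q)) + wirt 'i%C (wirt (- 'i%C) Y) q)%MS.
pose Vp q := kermx (lorentz_mx R[i] 7 *m (V q)^T).
have VE q : V_C y q = V q by rewrite /V_C !dz_wirt dzbar_wirt.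
have VpE q : Vperp_C y q = Vp q by rewrite /Vperp_C VE.
have DE psi : Dzbar y psi = fun q => wirt 'i%C psi q *m proj_mx (Vp q) (V q).
  by apply/funext => q; rewrite /Dzbar /normal_proj dzbar_wirt VE VpE.
have kV' q (Uq : U q) : (kappa q <= Vp q)%MS by rewrite -VpE; exact: kV.
have EV i q (Uq : U q) : (E i q <= Vp q)%MS.
  by rewrite -VpE; have [_ h] := if_section fE i; exact: h.
have sE i : csmooth_on U (E i) by have [h _] := if_section fE i.
have kE q (Uq : U q) : (kappa q <= span2 E q)%MS by have [h _ _] := if_kappa fE Uq.
have DkE q (Uq : U q) : (wirt 'i%C kappa q *m proj_mx (Vp q) (V q) <= span2 E q)%MS.
  by have [_ _] := if_kappa fE Uq; rewrite DE.
have DEE i q (Uq : U q) : (wirt 'i%C (E i) q *m proj_mx (Vp q) (V q) <= span2 E q)%MS.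
  by have [_] := if_parallel fE i Uq; rewrite DE.
rewrite !DE.
exact: (willmore_equation oU (csmooth_lift oU ciy) (fun q _ => conj_lift y q)
  (lift_null ciy) ZZ (lift_normalized oU ciy) sk kV' hopfE sE EV kE DkE
  (if_isotropic fE) (if_unitary fE) DEE Up).
Qed.
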